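(* Let $G$ be a group and $T$ a type of algebras. The subcategory $\mathsf A(G,\mathsf{Al}(T))$ is reflective in $\mathsf{pA}(G,\mathsf{Al}(T))$.
   Context: A partial action of a group $G$ on a set $A$ is a partial map $\theta:G\times A\dashrightarrow A$ such that for all $x,y\in G$, $a\in A$: (i) $\theta(1,a)$ is defined and equals $a$; (ii) if $\theta(x,a)$ is defined, then $\theta(x^{-1},\theta(x,a))$ is defined and equals $a$; (iii) if $\theta(y,a)$ and $\theta(x,\theta(y,a))$ are defined, then $\theta(xy,a)$ is defined and equals $\theta(x,\theta(y,a))$. It is global if everywhere defined. One writes $xa$ for $\theta(x,a)$. The domain $D_x$ is the set $\{\theta(x,a)\mid a\in A,\ \theta(x,a)\text{ defined}\}$, and $\theta_x=\theta(x,-)$ is a bijection $D_{x^{-1}}\to D_x$. A type of algebras is a sequence $T=\{n_\gamma\}_{\gamma<o(T)}$ of non-negative integers indexed by ordinals; $\mathsf{Al}(T)$ is the category of (total) algebras of type $T$, i.e. sets $A$ with operations $f_\gamma:A^{n_\gamma}\to A$, and homomorphisms. $\mathsf{pA}(G,\mathsf{Al}(T))$ is the category whose objects are the pairs $(\theta,\mathcal A)$ with $\mathcal A\in\mathsf{Al}(T)$ and $\theta$ a partial action of $G$ on the set $A$ such that every $D_x$ is (the underlying set of) a subalgebra $\mathcal D_x$ of $\mathcal A$ and every $\theta_x:\mathcal D_{x^{-1}}\to\mathcal D_x$ is an isomorphism of algebras. Its morphisms $(\theta,\mathcal A)\to(\theta',\mathcal A')$ are the algebra homomorphisms $\varphi:\mathcal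 A\to\mathcal A'$ such that whenever $\theta(x,a)$ is defined, $\theta'(x,\varphi(a))$ is defined and equals $\varphi(\theta(x,a))$. $\mathsf A(G,\mathsf{Al}(T))$ is the full subcategory of pairs with global $\theta$. A subcategory $\mathsf D$ of a category $\mathsf C$ is reflective if for any object $C\in\mathsf C$ there exist an object $R\in\mathsf D$ and a morphism $\varepsilon:C\to R$ such that for all $D\in\mathsf D$ and $\varphi:C\to D$ there is a unique $\psi:R\to D$ in $\mathsf D$ with $\psi\circ\varepsilon=\varphi$. *)

(* Defs.v *)
From mathcomp Require Import all_boot monoid.
From mathcomp Require Import boolp classical_sets.

Set Implicit Arguments.
Unset Strict Implicit.
Unset Printing Implicit Defensive.

Local Open Scope classical_set_scope.
Local Open Scope group_scope.

Record category := Category {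
  obj :> Type;
  mor : obj -> obj -> Type;
  idm : forall A, mor A A;
  compm : forall A B C, mor B C -> mor A B -> mor A C;
  compm1 : forall A B (f : mor A B), compm f (idm A) = f;
  comp1m : forall A B (f : mor A B), compm (idm B) f = f;
  compmA : forall A B C D (h : mor C D) (g : mor B C) (f : mor A B),
    compm h (compm g f) = compm (compm h g) f
}.

Record subcategory (C : category) := Subcategory {
  sub_obj : C -> Prop;
  sub_mor : forall A B : C, mor A B -> Prop;
  sub_idm : forall A : C, sub_obj A -> sub_mor (idm A);
  sub_compm : forall (A B D : C) (g : mor B D) (f : mor A B),
    sub_obj A -> sub_obj B -> sub_obj D ->
    sub_mor g -> sub_mor f -> sub_mor (compm g f)
}.

Definition full_subcategory (C : category) (P : C -> Prop) : subcategory C :=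
  @Subcategory C P (fun _ _ _ => True)
    (fun _ _ => I) (fun _ _ _ _ _ _ _ _ _ _ => I).

Definition reflective (C : category) (D : subcategory C) : Prop :=
  forall X : C, exists (R : C) (eps : mor X R), sub_obj D R /\
    forall (Y : C) (phi : mor X Y), sub_obj D Y ->
      exists! psi : mor R Y, sub_mor D psi /\ compm psi eps = phi.

(* Only the family of arities matters: the ordinals indexing the operations
   are replaced by an arbitrary set of operation symbols. *)
Record algebra_type := AlgebraType {
  symbol : Type;
  arity : symbol -> nat
}.

Record algebra (T : algebra_type) := Algebra {
  carrier :> Type;
  op : forall s : symbol T, ('I_(arity s) -> carrier) -> carrier
}.

Definition is_hom (T : algebra_type) (A B : algebra T) (f : A -> B) : Prop :=
  forall (s : symbol T) (a : 'I_(arity s) -> A),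
    f (op a) = op (fun i => f (a i)).

Definition is_iso (T : algebra_type) (A B : algebra T) (f : A -> B) : Prop :=
  is_hom f /\ bijective f.

Definition is_subalgebra (T : algebra_type) (A : algebra T) (S : set A) : Prop :=
  forall (s : symbol T) (a : 'I_(arity s) -> A),
    (forall i, S (a i)) -> S (op a).

Definition subalgebra (T : algebra_type) (A : algebra T) (S : set A)
    (hS : is_subalgebra S) : algebra T :=
  @Algebra T {a : A | S a} (fun s a =>
    exist S (op (fun i => sval (a i))) (hS s _ (fun i => svalP (a i)))).

(* [act x a = None] means that the partial map is undefined at [(x, a)]. *)
Record partial_action (G : groupType) (A : Type) := PartialAction {
  act :> G -> A -> option A;
  act1 : forall a, act 1 a = Some a;
  actV : forall x a b, act x a = Some b -> act x^-1 b = Some a;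
  actM : forall x y a b c,
    act y a = Some b -> act x b = Some c -> act (x * y) a = Some c
}.

Definition is_global (G : groupType) (A : Type) (theta : partial_action G A) :
    Prop :=
  forall x a, exists b, theta x a = Some b.

Definition act_dom (G : groupType) (A : Type) (theta : partial_action G A)
    (x : G) : set A :=
  [set b | exists a, theta x a = Some b].

Lemma act_dom_defined (G : groupType) (A : Type) (theta : partial_action G A)
    (x : G) (a : A) :
  act_dom theta x^-1 a -> exists b, theta x a = Some b.
Proof. by case=> c /(@actV _ _ theta); rewrite invgK => e; exists c. Qed.

Definition act_map (G : groupType) (A : Type) (theta : partial_action G A)
    (x : G) (u : {a : A | act_dom theta x^-1 a}) : {b : A | act_dom theta x b} :=
  let: exist b e := cid (act_dom_defined (svalP u)) in
  exist (act_dom theta x) b (ex_intro _ (sval u) e).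

Lemma act_mapP (G : groupType) (A : Type) (theta : partial_action G A) (x : G)
    (u : {a : A | act_dom theta x^-1 a}) :
  theta x (sval u) = Some (sval (act_map u)).
Proof. by rewrite /act_map; case: cid. Qed.

Record pact_algebra (G : groupType) (T : algebra_type) := PactAlgebra {
  pact_alg :> algebra T;
  pact : partial_action G pact_alg;
  pact_sub : forall x, is_subalgebra (act_dom pact x);
  pact_iso : forall x,
    @is_iso T (subalgebra (@pact_sub x^-1)) (subalgebra (@pact_sub x))
      (@act_map G pact_alg pact x)
}.

Record pact_mor (G : groupType) (T : algebra_type) (A B : pact_algebra G T) :=
  PactMor {
  pact_fun :> A -> B;
  pact_hom : is_hom pact_fun;
  pact_equiv : forall x a b,
    pact A x a = Some b -> pact B x (pact_fun a) = Some (pact_fun b)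
}.

Lemma pact_mor_eq (G : groupType) (T : algebra_type) (A B : pact_algebra G T)
    (f g : pact_mor A B) : (forall a, f a = g a) -> f = g.
Proof.
case: f g => [f fh fe] [g gh ge] /= /funext fg; subst g.
by congr PactMor; apply: Prop_irrelevance.
Qed.

Definition pact_id (G : groupType) (T : algebra_type) (A : pact_algebra G T) :
    pact_mor A A :=
  @PactMor G T A A (fun a => a) (fun _ _ => erefl) (fun _ _ _ e => e).

Lemma pact_comp_hom (G : groupType) (T : algebra_type)
    (A B C : pact_algebra G T) (g : pact_mor B C) (f : pact_mor A B) :
  is_hom (fun a => g (f a)).
Proof. by move=> s a; rewrite !pact_hom. Qed.

Definition pact_comp (G : groupType) (T : algebra_type)
    (A B C : pact_algebra G T) (g : pact_mor B C) (f : pact_mor A B) :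
    pact_mor A C :=
  @PactMor G T A C (fun a => g (f a)) (pact_comp_hom g f)
    (fun _ _ _ e => pact_equiv g (pact_equiv f e)).

Definition pA (G : groupType) (T : algebra_type) : category :=
  @Category (pact_algebra G T) (@pact_mor G T) (@pact_id G T) (@pact_comp G T)
    (fun A B f => @pact_mor_eq G T A B (pact_comp f (pact_id A)) f
       (fun=> erefl))
    (fun A B f => @pact_mor_eq G T A B (pact_comp (pact_id B) f) f
       (fun=> erefl))
    (fun A B C D h g f => @pact_mor_eq G T A D
       (pact_comp h (pact_comp g f)) (pact_comp (pact_comp h g) f)
       (fun=> erefl)).

Definition globA (G : groupType) (T : algebra_type) : subcategory (pA G T) :=
  @full_subcategory (pA G T) (fun A : pact_algebra G T => is_global (pact A)).

(* Main.v *)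
Require Import Defs.
From HB Require Import structures.
From mathcomp Require Import all_boot monoid.
From mathcomp Require Import boolp.

(** The reflection of a partial action of [G] on an algebra [A] is the algebra
    generated by formal translates [g a], with [g] in [G] and [a] in [A],
    subject to the relations that any global target forces on them: every
    translation [a |-> g a] is a homomorphism, and [(g x) a] equals [g b]
    whenever [x a] is already defined in [A] with value [b].

    Concretely this is the algebra of terms with variables in [G * A] modulo
    the least congruence [cong] containing these relations.  Multiplying the
    group components of the variables on the left preserves the relations
    ([cong_shift]), so [G] acts on the quotient, globally and by
    homomorphisms.  The unit sends [a] to the class of the variable [(1, a)];
    the two families of relations are what makes it a homomorphism and makes
    it compatible with the partial action.

    A morphism [phi] into a global [Y] must send the variable [(g, a)] to
    [g (phi a)], because the class of that variable is the translate by [g] of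
    the image of [a].  Terms are then determined by recursion, which gives
    uniqueness, and the evaluation so defined is constant on the classes
    ([cong_eval]), which gives existence. *)

Set Implicit Arguments.
Unset Strict Implicit.
Unset Printing Implicit Defensive.

Local Open Scope group_scope.
Local Open Scope quotient_scope.

(** * Global actions by homomorphisms *)

Lemma sval_inj (S : Type) (P : S -> Prop) : injective (@sval S P).
Proof. by move=> u v; apply: eq_sig_hprop => x; apply: Prop_irrelevance. Qed.

Section GlobalAction.
Variables (G : groupType) (T : algebra_type) (A : algebra T).
Variable m : G -> A -> A.
Hypothesis m1 : forall a, m 1 a = a.
Hypothesis mM : forall x y a, m (x * y) a = m x (m y a).
Hypothesis m_hom : forall x, is_hom (m x).

Lemma total_mK x : cancel (m x) (m x^-1).
Proof. by move=> a; rewrite -mM mulVg m1. Qed.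

Lemma total_mVK x : cancel (m x^-1) (m x).
Proof. by move=> a; rewrite -mM mulgV m1. Qed.

Definition total_action : partial_action G A.
Proof.
refine (@PartialAction G A (fun x a => Some (m x a)) _ _ _).
- by move=> a; rewrite m1.
- by move=> x a _ [<-]; rewrite total_mK.
- by move=> x y a _ _ [<-] [<-]; rewrite mM.
Defined.

Lemma total_action_dom x a : act_dom total_action x a.
Proof. by exists (m x^-1 a); rewrite /= total_mVK. Qed.

Lemma total_action_sub x : is_subalgebra (act_dom total_action x).
Proof. by move=> s a _; apply: total_action_dom. Qed.

Lemma total_act_mapE x (u : {a : A | act_dom total_action x^-1 a}) :
  sval (act_map u) = m x (sval u).
Proof. by have [] := act_mapP u. Qed.

Lemma total_action_iso x :
  @is_iso T (subalgebra (@total_action_sub x^-1))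
    (subalgebra (@total_action_sub x)) (@act_map G A total_action x).
Proof.
split=> [s a|].
  apply: sval_inj; rewrite total_act_mapE /= m_hom.
  by congr op; apply/funext => i; rewrite total_act_mapE.
exists (fun v => exist _ (m x^-1 (sval v)) (total_action_dom _ _)) => [u|v].
  by apply: sval_inj; rewrite total_act_mapE total_mK.
by apply: sval_inj; rewrite total_act_mapE /= total_mVK.
Qed.

Definition total_pact_algebra : pact_algebra G T :=
  PactAlgebra total_action_iso.

End GlobalAction.

Section GlobalPact.
Variables (G : groupType) (T : algebra_type) (B : pact_algebra G T).
Hypothesis glB : is_global (pact B).

Definition gact x b : B := sval (cid (glB x b)).

Lemma gactP x b : pact B x b = Some (gact x b).
Proof. exact: svalP (cid (glB x b)). Qed.

Lemma gactE x b c : pact B x b = Some c -> gact x b = c.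
Proof. by rewrite gactP => -[]. Qed.

Lemma gact1 b : gact 1 b = b.
Proof. exact/gactE/act1. Qed.

Lemma gactM x y b : gact (x * y) b = gact x (gact y b).
Proof. by apply: gactE; apply: actM; exact: gactP. Qed.

Lemma gact_dom x b : act_dom (pact B) x b.
Proof. by exists (gact x^-1 b); rewrite gactP -gactM mulgV gact1. Qed.

(** Since every domain is the whole of [B], the isomorphism between the
    domains of [x^-1] and [x] is an endomorphism of [B] itself. *)
Lemma gact_hom x : is_hom (gact x).
Proof.
move=> s b; have [iso_hom _] := pact_iso B x.
pose u i : {a : B | act_dom (pact B) x^-1 a} := exist _ (b i) (gact_dom _ (b i)).
have /(congr1 sval) /= := iso_hom s u.
have svalE v : sval (@act_map _ _ (pact B) x v) = gact x (sval v).
  by apply/esym/gactE/act_mapP.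
by rewrite svalE => ->; congr op; apply/funext => i; rewrite svalE.
Qed.

End GlobalPact.

(** * Terms in formal translates *)

Inductive term (G A : Type) (T : algebra_type) : Type :=
| leaf of G & A
| node (s : symbol T) of ('I_(arity s) -> term G A T).

Arguments leaf {G A T}.
Arguments node {G A T}.

(* A classical choice function on terms selects the representatives of the
   classes, through which the operations act on the quotient. *)
HB.instance Definition _ G A T := gen_eqMixin (term G A T).
HB.instance Definition _ G A T := gen_choiceMixin (term G A T).

Definition term_algebra G A T : algebra T :=
  @Algebra T (term G A T) (@node G A T).

Fixpoint eval (G A : Type) (T : algebra_type) (B : algebra T) (f : G -> A -> B)
    (t : term G A T) : B :=
  match t with
  | leaf g a => f g a
  | node s u => op (fun i => eval f (u i))
  end.

Section Reflection.
Variables (G : groupType) (T : algebra_type) (A : pact_algebra G T).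

Local Notation tm := (term G A T).

Inductive cong : tm -> tm -> Prop :=
| cong_refl t : cong t t
| cong_sym t u : cong t u -> cong u t
| cong_trans t u v : cong t u -> cong u v -> cong t v
| cong_node s a b : (forall i, cong (a i) (b i)) -> cong (node s a) (node s b)
| cong_op g s (a : 'I_(arity s) -> A) :
    cong (leaf g (op a)) (node s (fun i => leaf g (a i)))
| cong_act g x a b : pact A x a = Some b -> cong (leaf (g * x) a) (leaf g b).

(** An assignment of the variables that satisfies the defining relations, even
    only up to a congruence [e] on the target, factors through [cong].  With
    [e] the equality this is the universal property; with [e] equal to [cong]
    itself it shows that the group acts on classes. *)
Lemma cong_eval_mod (B : algebra T) (e : B -> B -> Prop) (f : G -> A -> B) :
    (forall b, e b b) -> (forall b c, e b c -> e c b) ->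
    (forall b c d, e b c -> e c d -> e b d) ->
    (forall s (b c : 'I_(arity s) -> B),
      (forall i, e (b i) (c i)) -> e (op b) (op c)) ->
    (forall g s (a : 'I_(arity s) -> A),
      e (f g (op a)) (op (fun i => f g (a i)))) ->
    (forall g x a b, pact A x a = Some b -> e (f (g * x) a) (f g b)) ->
  forall t u, cong t u -> e (eval f t) (eval f u).
Proof.
move=> er es et en eop eact t u; elim=> {t u} /=; [by []| | | | |].
- by move=> t u _; apply: es.
- by move=> t u v _ tu _; apply: et.
- by move=> s a b _; apply: en.
- by move=> g s a; apply: eop.
- by move=> g x a b; apply: eact.
Qed.

Definition shift (g : G) : tm -> tm :=
  @eval G A T (term_algebra G A T) (fun h a => leaf (g * h) a).

Lemma cong_shift g t u : cong t u -> cong (shift g t) (shift g u).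
Proof.
apply: (@cong_eval_mod (term_algebra G A T) cong).
- exact: cong_refl.
- exact: cong_sym.
- exact: cong_trans.
- exact: cong_node.
- by move=> h s a; apply: cong_op.
- by move=> h x a b xab; rewrite mulgA; apply: cong_act.
Qed.

Lemma shift1 t : shift 1 t = t.
Proof.
elim: t => [h a|s u IH]; first by rewrite /shift /= mul1g.
by congr node; apply/funext => i; apply: IH.
Qed.

Lemma shiftM x y t : shift (x * y) t = shift x (shift y t).
Proof.
elim: t => [h a|s u IH]; first by rewrite /shift /= mulgA.
by congr node; apply/funext => i; apply: IH.
Qed.

(** * The quotient and its universal property *)

Definition congb : rel tm := fun t u => `[< cong t u >].

Lemma congb_refl : reflexive congb.
Proof. by move=> t; apply/asboolP/cong_refl. Qed.

Lemma congb_sym : symmetric congb.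
Proof. by move=> t u; apply/asbool_equiv_eq; split; apply: cong_sym. Qed.

Lemma congb_trans : transitive congb.
Proof.
by move=> u t v /asboolP tu /asboolP uv; apply/asboolP/(cong_trans tu uv).
Qed.

Canonical cong_equiv := EquivRel congb congb_refl congb_sym congb_trans.

Definition quot := {eq_quot cong_equiv}.

Definition class (t : tm) : quot := \pi_quot t.

Lemma class_repr q : class (repr q) = q.
Proof. exact: reprK. Qed.

Lemma classP t u : class t = class u <-> cong t u.
Proof. by split=> [/eqmodP/asboolP|tu]; last exact/eqmodP/asboolP. Qed.

Lemma cong_repr t : cong (repr (class t)) t.
Proof. by apply/classP; rewrite class_repr. Qed.

Definition quot_algebra : algebra T :=
  @Algebra T quot (fun s q => class (node s (fun i => repr (q i)))).

Lemma class_node s (u : 'I_(arity s) -> tm) :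
  class (node s u) = @op T quot_algebra s (fun i => class (u i)).
Proof.
by apply/classP/cong_node => i; apply/cong_sym/cong_repr.
Qed.

Definition translate (g : G) (q : quot_algebra) : quot_algebra :=
  class (shift g (repr q)).

Lemma translate_class g t : translate g (class t) = class (shift g t).
Proof. exact/classP/cong_shift/cong_repr. Qed.

Lemma translate1 q : translate 1 q = q.
Proof. by rewrite /translate shift1 class_repr. Qed.

Lemma translateM x y q : translate (x * y) q = translate x (translate y q).
Proof. by rewrite -(class_repr q) !translate_class shiftM. Qed.

Lemma translate_hom g : is_hom (translate g).
Proof. by move=> s q; rewrite translate_class class_node. Qed.

Definition globalization : pact_algebra G T :=
  total_pact_algebra translate1 translateM translate_hom.

Lemma globalization_global : is_global (pact globalization).
Proof. by move=> x q; exists (translate x q). Qed.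

Definition unit_fun (a : A) : globalization := class (leaf 1 a).

Lemma translate_unit g a : translate g (unit_fun a) = class (leaf g a).
Proof. by rewrite translate_class /shift /= mulg1. Qed.

Lemma unit_hom : is_hom unit_fun.
Proof. by move=> s a; rewrite -class_node; apply/classP/cong_op. Qed.

Lemma unit_equiv x a b :
  pact A x a = Some b -> pact globalization x (unit_fun a) = Some (unit_fun b).
Proof.
move=> xab; congr Some; rewrite translate_unit.
by apply/classP; rewrite -(mul1g x); apply: cong_act.
Qed.

Definition unit_mor : pact_mor A globalization := PactMor unit_hom unit_equiv.

Section Extension.
Variables (Y : pact_algebra G T) (phi : pact_mor A Y).
Hypothesis glY : is_global (pact Y).

Definition ext_term : tm -> Y := eval (fun g a => gact glY g (phi a)).

Lemma cong_eval t u : cong t u -> ext_term t = ext_term u.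
Proof.
apply: (@cong_eval_mod Y eq) => // [b c d -> //|s b c /funext -> //|g s a|].
  by rewrite pact_hom gact_hom.
by move=> g x a b /(pact_equiv phi) xab; rewrite gactM (gactE glY xab).
Qed.

Lemma ext_term_shift g t : ext_term (shift g t) = gact glY g (ext_term t).
Proof.
elim: t => [h a|s u IH]; first by rewrite /ext_term /= gactM.
rewrite [RHS]gact_hom; congr op; apply/funext => i; exact: IH.
Qed.

Definition ext_fun (q : globalization) : Y := ext_term (repr (q : quot)).

Lemma ext_fun_class t : ext_fun (class t) = ext_term t.
Proof. exact/cong_eval/cong_repr. Qed.

Lemma ext_hom : is_hom ext_fun.
Proof. by move=> s q; rewrite [LHS]ext_fun_class. Qed.

Lemma ext_equiv x p q :
  pact globalization x p = Some q -> pact Y x (ext_fun p) = Some (ext_fun q).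
Proof.
by case=> <-; rewrite (gactP glY) [in RHS]ext_fun_class ext_term_shift.
Qed.

Definition ext_mor : pact_mor globalization Y := PactMor ext_hom ext_equiv.

Lemma ext_unit a : ext_mor (unit_mor a) = phi a.
Proof. by rewrite [LHS]ext_fun_class /ext_term /= gact1. Qed.

(** Translates of the image of the unit generate the quotient as an algebra,
    so two morphisms that agree on that image agree everywhere. *)
Lemma ext_unique (psi : pact_mor globalization Y) :
  (forall a, psi (unit_mor a) = phi a) -> forall q, psi q = ext_mor q.
Proof.
move=> psiE q; rewrite -(class_repr q) [RHS]ext_fun_class.
elim: (repr _) => [g a|s u IH].
  rewrite -translate_unit /ext_term /= -psiE; apply/esym/gactE.
  exact: pact_equiv.
rewrite class_node; rewrite [LHS](pact_hom psi).
by congr op; apply/funext => i; apply: IH.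
Qed.

End Extension.
End Reflection.

Theorem proposition3p8 (G : groupType) (T : algebra_type) :
  reflective (globA G T).
Proof.
move=> A; exists (globalization A), (unit_mor A); split.
  exact: globalization_global.
move=> Y phi glY; exists (ext_mor phi glY); split.
  by split=> //; apply: pact_mor_eq => a; apply: ext_unit.
move=> psi [_ psiE]; apply: pact_mor_eq => q; apply/esym/ext_unique => a.
by rewrite -psiE.
Qed.
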